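(* Let $X, Y \in \mathbb{C}^{n\times m}$ have rows $\tilde x_1,\dots,\tilde x_n$ and $\tilde y_1,\dots,\tilde y_n$ in $\mathbb{C}^{1\times m}$, and set $\tilde x_0 = \tilde x_{n+1} = 0$. The minimum-norm solution of the tridiagonal Procrustes problem $$\min\{\|Y - AX\|_F : A\in\mathbb{C}^{n\times n} \text{ tridiagonal}\}$$ is the tridiagonal matrix $A$ with entries $A_{i,i-1} = \alpha_i$, $A_{i,i} = \beta_i$, $A_{i,i+1} = \gamma_i$ (with the convention $\alpha_1 = \gamma_n = 0$) given by $$\begin{bmatrix}\alpha_i & \beta_i & \gamma_i\end{bmatrix} = \tilde y_i \begin{bmatrix}\tilde x_{i-1}\\ \tilde x_i\\ \tilde x_{i+1}\end{bmatrix}^{\dagger}, \qquad 1\le i\le n.$$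
   Context: $A$ is tridiagonal if $A_{i,k}=0$ whenever $|i-k|>1$. $\|\cdot\|_F$ is the Frobenius norm, $\dagger$ is the Moore--Penrose pseudoinverse, and ''minimum-norm solution'' means the minimizer whose rows (equivalently, which itself in Frobenius norm) have the smallest Euclidean norm among all minimizers. *)

(* Defs.v *)
From HB Require Import structures.
From mathcomp Require Import all_boot all_order all_algebra.
From mathcomp Require Import sesquilinear spectral.
From mathcomp Require Import reals.
From mathcomp Require Import complex.

Set Implicit Arguments.
Unset Strict Implicit.
Unset Printing Implicit Defensive.

Import Order.TTheory GRing.Theory Num.Theory.
Local Open Scope ring_scope.
Local Open Scope sesquilinear_scope.

Section Pseudoinverse.
Variable C : numClosedFieldType.

(* The four Penrose conditions; M ^t* is the conjugate transpose. *)
Definition penrose p q (A : 'M[C]_(p, q)) (P : 'M[C]_(q, p)) : bool :=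
  [&& A *m P *m A == A, P *m A *m P == P,
      (A *m P) ^t* == A *m P & (P *m A) ^t* == P *m A].

Lemma ctmxM p q r (A : 'M[C]_(p, q)) (B : 'M[C]_(q, r)) :
  (A *m B) ^t* = B ^t* *m A ^t*.
Proof. by rewrite trmx_mul map_mxM. Qed.

Lemma ctmxK p q (A : 'M[C]_(p, q)) : (A ^t*) ^t* = A.
Proof. by apply/matrixP => i j; rewrite !mxE conjCK. Qed.

Lemma gram_rV_eq0 q (u : 'rV[C]_q) : u *m u ^t* = 0 -> u = 0.
Proof.
move=> /matrixP/(_ 0 0); rewrite !mxE => u0; apply/rowP => j.
have := u0; under eq_bigr => k _ do rewrite !mxE -normCK.
move/eqP; rewrite psumr_eq0 => [/allP/(_ j)|k _]; last exact: exprn_ge0.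
by rewrite mem_index_enum mxE => /(_ isT); rewrite sqrf_eq0 normr_eq0 => /eqP.
Qed.

Lemma gram_unit p q (A : 'M[C]_(p, q)) : row_free A -> A *m A ^t* \in unitmx.
Proof.
move=> Afree; rewrite -row_free_unit -kermx_eq0; apply/rowV0P => v.
rewrite sub_kermx => /eqP vAA; apply: (row_free_inj Afree); rewrite mul0mx.
by apply: gram_rV_eq0; rewrite ctmxM mulmxA -(mulmxA v) vAA mul0mx.
Qed.

Lemma penrose_factor p q r (L : 'M[C]_(p, r)) (T : 'M[C]_(r, q)) :
  row_full L -> row_free T -> exists P, penrose (L *m T) P.
Proof.
move=> Lfull Tfree.
have uT : T *m T ^t* \in unitmx by exact: gram_unit.
have uL : L ^t* *m L \in unitmx.
  rewrite -[X in _ *m X]ctmxK; apply: gram_unit.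
  by rewrite /row_free mxrank_map mxrank_tr.
set G := invmx (T *m T ^t*); set H := invmx (L ^t* *m L).
have TG : T *m (T ^t* *m G) = 1%:M by rewrite mulmxA mulmxV.
have HL : (H *m L ^t*) *m L = 1%:M by rewrite -mulmxA mulVmx.
have hG : G ^t* = G by rewrite /G trmx_inv map_invmx ctmxM ctmxK.
have hH : H ^t* = H by rewrite /H trmx_inv map_invmx ctmxM ctmxK.
pose P := (T ^t* *m G) *m (H *m L ^t*); exists P.
have AP : (L *m T) *m P = L *m (H *m L ^t*).
  by rewrite /P -mulmxA [T *m _]mulmxA TG mul1mx.
have PA : P *m (L *m T) = (T ^t* *m G) *m T.
  by rewrite /P -mulmxA [_ *m (L *m T)]mulmxA HL mul1mx.
apply/and4P; split; apply/eqP.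
- by rewrite AP -mulmxA [_ *m (L *m T)]mulmxA HL mul1mx.
- by rewrite PA /P -mulmxA [T *m _]mulmxA TG mul1mx.
- by rewrite AP !ctmxM ctmxK hH mulmxA.
- by rewrite PA !ctmxM ctmxK hG mulmxA.
Qed.

Lemma penrose_exists p q (A : 'M[C]_(p, q)) : exists P, penrose A P.
Proof.
have := penrose_factor (col_base_full A) (row_base_free A).
by rewrite mulmx_base.
Qed.

Lemma penrose_unique p q (A : 'M[C]_(p, q)) (P Q : 'M[C]_(q, p)) :
  penrose A P -> penrose A Q -> P = Q.
Proof.
case/and4P=> /eqP P1 /eqP P2 /eqP P3 /eqP P4.
case/and4P=> /eqP Q1 /eqP Q2 /eqP Q3 /eqP Q4.
have APQ : A *m P = A *m Q.
  rewrite -[A in LHS]Q1 -mulmxA -[in LHS]Q3 -[A *m P]P3 -ctmxM.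
  by rewrite [A *m P *m _]mulmxA P1 Q3.
have PQA : P *m A = Q *m A.
  rewrite -[A in LHS]Q1 -[A *m Q *m A]mulmxA [P *m _]mulmxA.
  by rewrite -[in LHS]P4 -[in LHS]Q4 -ctmxM -mulmxA [A *m (P *m A)]mulmxA P1 Q4.
by rewrite -P2 PQA -mulmxA APQ mulmxA Q2.
Qed.

Definition mp_pinv p q (A : 'M[C]_(p, q)) : 'M[C]_(q, p) :=
  xchoose (penrose_exists A).

Lemma mp_pinvP p q (A : 'M[C]_(p, q)) : penrose A (mp_pinv A).
Proof. exact: xchooseP. Qed.

End Pseudoinverse.

Section Procrustes.
Variable C : numClosedFieldType.

(* The value lies in C but is always a nonnegative real, so two such norms are
   comparable for the partial order on C. On a row it is the Euclidean norm. *)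
Definition frob p q (A : 'M[C]_(p, q)) : C :=
  sqrtC (\sum_i \sum_j `|A i j| ^+ 2).

Definition tridiagonal n (A : 'M[C]_n) : Prop :=
  forall i k : 'I_n, `|i%:Z - k%:Z| > 1 -> A i k = 0.

Definition procrustes_minimizer n m (X Y : 'M[C]_(n, m)) (A : 'M[C]_n) : Prop :=
  tridiagonal A /\
  forall B, tridiagonal B -> frob (Y - A *m X) <= frob (Y - B *m X).

Definition min_row_norm_solution n m (X Y : 'M[C]_(n, m)) (A : 'M[C]_n) : Prop :=
  procrustes_minimizer X Y A /\
  forall B, procrustes_minimizer X Y B ->
    forall i, frob (row i A) <= frob (row i B).

Definition min_frob_norm_solution n m (X Y : 'M[C]_(n, m)) (A : 'M[C]_n) : Prop :=
  procrustes_minimizer X Y A /\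
  forall B, procrustes_minimizer X Y B -> frob A <= frob B.

(* 1-based indices: [ord1b n k] is the index k if 1 <= k <= n, and None
   otherwise. Rows and entries at indices outside 1..n are read as 0. *)
Definition ord1b n (k : nat) : option 'I_n :=
  if k is k'.+1 then insub k' else None.

Definition row1b n m (X : 'M[C]_(n, m)) (k : nat) : 'rV[C]_m :=
  if ord1b n k is Some i then row i X else 0.

Definition entry1b n m (A : 'M[C]_(n, m)) (k l : nat) : C :=
  if ord1b m l is Some j then row1b A k 0 j else 0.

(* For 1 <= i <= n: the rows of X with indices i-1, i, i+1, stacked. *)
Definition stencil n m (X : 'M[C]_(n, m)) (i : nat) : 'M[C]_(3, m) :=
  \matrix_(r < 3) row1b X (i.-1 + r).

(* For 1 <= i <= n: the entries (i,i-1), (i,i), (i,i+1) of A; those which fall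
   outside the matrix, at (1,0) and (n,n+1), are 0. *)
Definition band n (A : 'M[C]_n) (i : nat) : 'rV[C]_3 :=
  \row_(r < 3) entry1b A i (i.-1 + r).

End Procrustes.

(* Main.v *)
Require Import Defs.
From mathcomp Require Import all_boot all_order all_algebra.
From mathcomp Require Import reals complex.
From mathcomp Require Import sesquilinear spectral zify.

(** For tridiagonal [B] the problem decouples into the [n] least squares
    problems [y_i ~ b T_i], with [b] the band of row [i] of [B] and [T_i] the
    stencil, [P_i] its pseudoinverse. By Pythagoras
    [|y_i - b T_i|^2 = |y_i - y_i P_i T_i|^2 + |(y_i P_i - b) T_i|^2], and
    whenever [b T_i = y_i P_i T_i] also
    [|b|^2 = |y_i P_i|^2 + |b - y_i P_i|^2].  Zero rows of [T_i] give zero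
    entries of [y_i P_i], so these bands fit together into a tridiagonal
    matrix. *)

Set Implicit Arguments.
Unset Strict Implicit.
Unset Printing Implicit Defensive.

Import Order.TTheory GRing.Theory Num.Theory.

Local Open Scope ring_scope.
Local Open Scope sesquilinear_scope.

Section SquaredNorm.
Variable C : numClosedFieldType.

(** The trace form turns norm identities into matrix identities. *)
Definition sqfrob p q (A : 'M[C]_(p, q)) : C := \tr (A *m A ^t*).

Lemma sqfrobE p q (A : 'M[C]_(p, q)) :
  sqfrob A = \sum_i \sum_j `|A i j| ^+ 2.
Proof.
apply: eq_bigr => i _; rewrite mxE; apply: eq_bigr => j _.
by rewrite !mxE normCK.
Qed.

Lemma sqfrob_ge0 p q (A : 'M[C]_(p, q)) : 0 <= sqfrob A.
Proof. by rewrite sqfrobE; do 2![apply: sumr_ge0 => ? _]; apply: exprn_ge0. Qed.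

Lemma sqfrob_rows p q (A : 'M[C]_(p, q)) :
  sqfrob A = \sum_i sqfrob (row i A).
Proof.
rewrite sqfrobE; apply: eq_bigr => i _; rewrite sqfrobE big_ord1.
by apply: eq_bigr => j _; rewrite mxE.
Qed.

Lemma sqfrob_le0_eq0 p q (A : 'M[C]_(p, q)) : sqfrob A <= 0 -> A = 0.
Proof.
move=> A0; have {A0}: sqfrob A == 0 by rewrite eq_le A0 sqfrob_ge0.
rewrite sqfrobE psumr_eq0 => [/allP A0|i _]; last first.
  by apply: sumr_ge0 => ? _; apply: exprn_ge0.
apply/matrixP => i j; rewrite mxE.
have /= := A0 i (mem_index_enum i).
rewrite psumr_eq0 => [/allP/(_ j (mem_index_enum j))/=|k _]; last exact: exprn_ge0.
by rewrite sqrf_eq0 normr_eq0 => /eqP.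
Qed.

Lemma ler_frob p q p' q' (A : 'M[C]_(p, q)) (B : 'M[C]_(p', q')) :
  (frob A <= frob B) = (sqfrob A <= sqfrob B).
Proof. by rewrite /frob -!sqfrobE ler_sqrtC ?qualifE/= ?sqfrob_ge0. Qed.

Lemma sqfrobD p q (A B : 'M[C]_(p, q)) :
  A *m B ^t* = 0 -> sqfrob (A + B) = sqfrob A + sqfrob B.
Proof.
move=> AB0; have BA0 : B *m A ^t* = 0.
  by rewrite -[B in LHS]ctmxK -ctmxM AB0 trmx0 map_mx0.
rewrite /sqfrob linearD/= map_mxD mulmxDl !mulmxDr AB0 BA0 add0r addr0.
exact: mxtraceD.
Qed.

End SquaredNorm.

Section LeastSquares.
Variables (C : numClosedFieldType) (p q : nat) (T : 'M[C]_(p, q)).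

(** [P = P (T P)] with [T P] Hermitian. The trailing factor [T ^t*] makes [y P] orthogonal to the
    left kernel of [T], and kills the columns of [P] that belong to zero rows of [T]. *)
Lemma mp_pinv_adjoint : mp_pinv T = mp_pinv T *m (mp_pinv T) ^t* *m T ^t*.
Proof.
have /and4P[_ /eqP PTP /eqP TPh _] := mp_pinvP T.
by rewrite -mulmxA -ctmxM TPh mulmxA.
Qed.

(** The normal equations: [P T] is Hermitian, so [P T T ^t* = (T P T) ^t* = T ^t*]. *)
Lemma mp_pinv_residual_orthogonal r (y : 'M[C]_(r, q)) :
  (y - y *m mp_pinv T *m T) *m T ^t* = 0.
Proof.
have /and4P[/eqP TPT _ _ /eqP PTh] := mp_pinvP T.
by rewrite mulmxBl -!mulmxA [mp_pinv T *m _]mulmxA -PTh -ctmxM mulmxA TPT subrr.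
Qed.

Lemma sqfrob_residual r (y : 'M[C]_(r, q)) (b : 'M[C]_(r, p)) :
  sqfrob (y - b *m T) =
    sqfrob (y - y *m mp_pinv T *m T) + sqfrob ((y *m mp_pinv T - b) *m T).
Proof.
rewrite -sqfrobD; first by rewrite mulmxBl addrA subrK.
by rewrite ctmxM mulmxA mp_pinv_residual_orthogonal mul0mx.
Qed.

Lemma sqfrob_least_squares r (y : 'M[C]_(r, q)) (b : 'M[C]_(r, p)) :
  b *m T = y *m mp_pinv T *m T ->
  sqfrob b = sqfrob (y *m mp_pinv T) + sqfrob (b - y *m mp_pinv T).
Proof.
move=> bT; rewrite -sqfrobD; first by rewrite addrC subrK.
have : (b - y *m mp_pinv T) *m T = 0 by rewrite mulmxBl bT subrr.
move: (b - _) => e eT; rewrite mp_pinv_adjoint -!mulmxA -ctmxM eT.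
by rewrite trmx0 map_mx0 !mulmx0.
Qed.

End LeastSquares.

Section Bands.
Variables (C : numClosedFieldType) (n : nat).
Implicit Types (i j k : 'I_n).

(* The partial isometry selecting the coordinates i-1, i, i+1: bands and
   stencils are obtained by multiplying with it. *)
Definition select i : 'M[C]_(3, n) := stencil 1%:M i.+1.

(** Both sides of the test are 1-based: the ordinals [i] and [k] stand for the indices [i.+1] and
    [k.+1]. *)
Lemma selectE i r k : select i r k = (i + r == k.+1)%N%:R.
Proof.
rewrite mxE /row1b /ord1b /=; case: (i + r)%N => [|l]; first by rewrite mxE.
rewrite eqSS; case: insubP => [j _ <-|]; first by rewrite !mxE.
by rewrite mxE -leqNgt => nl; rewrite gtn_eqF // (leq_trans _ nl).
Qed.

Lemma stencil_select m (X : 'M[C]_(n, m)) i : stencil X i.+1 = select i *m X.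
Proof.
apply/row_matrixP => r; rewrite row_mul !rowK /row1b.
by case: ord1b => [j|]; rewrite ?mul0mx // -row_mul mul1mx.
Qed.

Lemma row1bS m (X : 'M[C]_(n, m)) i : row1b X i.+1 = row i X.
Proof. by rewrite /row1b /ord1b valK. Qed.

Lemma band_select (A : 'M[C]_n) i : band A i.+1 = row i A *m (select i)^T.
Proof.
apply/rowP => r; rewrite mxE /entry1b row1bS mxE.
under eq_bigr => k _ do rewrite [(select i)^T _ _]mxE selectE mxE.
rewrite /ord1b /=; case: (i + r)%N => [|l]; first by rewrite big1// => k _; rewrite mulr0.
case: insubP => [j _ jl|].
  rewrite (bigD1 j) //= jl eqxx mulr1 big1 ?addr0 ?mxE// => k kj.
  by rewrite eqSS -jl eq_sym -[_ == _]/(k == j) (negPf kj) mulr0.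
rewrite -leqNgt => nl; rewrite big1// => k _.
by rewrite eqSS gtn_eqF ?mulr0// (leq_trans _ nl).
Qed.

Lemma select_gramE i k l :
  ((select i)^T *m select i) k l = ((k == l) && (`|i%:Z - k%:Z| <= 1)%R)%:R.
Proof.
rewrite mxE; under eq_bigr => r _ do rewrite mxE !selectE -natrM mulnb.
rewrite -natr_sum; congr _%:R.
(* Unfolding the sum over the three rows leaves 0/1 terms in integer comparisons. *)
rewrite !big_ord_recl big_ord0 /= -[k == l]/(nat_of_ord k == l).
rewrite /bump /=; lia.
Qed.

Lemma mul_select_gram i m (u : 'M[C]_(m, n)) r k :
  (u *m ((select i)^T *m select i)) r k = u r k * (`|i%:Z - k%:Z| <= 1)%R%:R.
Proof.
rewrite mxE (bigD1 k) //= select_gramE eqxx big1 ?addr0// => l lk.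
by rewrite select_gramE (negPf lk) mulr0.
Qed.

(** At the boundary [select i] has a zero row, so [select i *m (select i)^T] need not be the
    identity; this weaker law survives. *)
Lemma select_partial_isometry i : select i *m ((select i)^T *m select i) = select i.
Proof.
apply/matrixP => r k; rewrite mul_select_gram selectE -natrM mulnb.
by congr (_%:R); congr nat_of_bool; have := ltn_ord r; lia.
Qed.

Lemma select_adjoint i : (select i) ^t* = (select i)^T.
Proof.
by apply/matrixP => k r; rewrite mxE [_^T k r]mxE selectE conjC_nat.
Qed.

(** Taking the band and spreading it back multiplies row [i] by a diagonal projection, which
    truncates it to the columns within distance 1 of [i]. *)
Lemma tridiagonalP (A : 'M[C]_n) :
  tridiagonal A <-> forall i, row i A = band A i.+1 *m select i.
Proof.
have E i k : (band A i.+1 *m select i) 0 k = A i k * (`|i%:Z - k%:Z| <= 1)%R%:R.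
  by rewrite band_select -mulmxA mul_select_gram mxE.
split=> [tA i|rA i k ik].
  apply/rowP => k; rewrite E mxE; case: (leP `|i%:Z - k%:Z| 1) => [_|/tA->].
    by rewrite mulr1.
  by rewrite mul0r.
by have /rowP/(_ k) := rA i; rewrite E mxE leNgt ik mulr0.
Qed.

Lemma row_mul_band m (X : 'M[C]_(n, m)) (A : 'M[C]_n) i :
  tridiagonal A -> row i (A *m X) = band A i.+1 *m stencil X i.+1.
Proof. by move=> /tridiagonalP tA; rewrite row_mul tA stencil_select mulmxA. Qed.

Lemma sqfrob_band (A : 'M[C]_n) i :
  tridiagonal A -> sqfrob (band A i.+1) = sqfrob (row i A).
Proof.
move=> /tridiagonalP/(_ i) tA; rewrite /sqfrob.
by rewrite {2}band_select ctmxM -select_adjoint ctmxK mulmxA -tA.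
Qed.

Lemma bandB (A B : 'M[C]_n) i : band (A - B) i.+1 = band A i.+1 - band B i.+1.
Proof. by rewrite !band_select linearB/= mulmxBl. Qed.

Lemma tridiagonalB (A B : 'M[C]_n) :
  tridiagonal A -> tridiagonal B -> tridiagonal (A - B).
Proof. by move=> tA tB i k ik; rewrite !mxE tA// tB// subr0. Qed.

End Bands.

Section TridiagonalProcrustes.
Variables (C : numClosedFieldType) (n m : nat) (X Y : 'M[C]_(n, m)).
Implicit Types (i : 'I_n) (B : 'M[C]_n).

Definition procrustes_solution : 'M[C]_n :=
  \matrix_i (row i Y *m mp_pinv (stencil X i.+1) *m select C i).
Let A := procrustes_solution.

Lemma band_procrustes_solution i :
  band A i.+1 = row i Y *m mp_pinv (stencil X i.+1).
Proof.
have PE : mp_pinv (stencil X i.+1) *m (select C i *m (select C i)^T)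
    = mp_pinv (stencil X i.+1).
  (* Occurrences 3 and 6 are the trailing factors [T ^t*] on the two sides; each becomes
     [X ^t* *m (select C i)^T], and the transposed partial isometry law absorbs the projection. *)
  rewrite mp_pinv_adjoint {3 6}stencil_select ctmxM select_adjoint -!mulmxA.
  by have /(congr1 trmx) := select_partial_isometry C i;
    rewrite !trmx_mul trmxK -!mulmxA => ->.
by rewrite band_select rowK -!mulmxA PE.
Qed.

Lemma tridiagonal_procrustes_solution : tridiagonal A.
Proof. by apply/tridiagonalP => i; rewrite band_procrustes_solution rowK. Qed.
Let tA := tridiagonal_procrustes_solution.

Lemma sqfrob_procrustes B : tridiagonal B ->
  sqfrob (Y - B *m X) = sqfrob (Y - A *m X) +
    \sum_(i < n) sqfrob ((band A i.+1 - band B i.+1) *m stencil X i.+1).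
Proof.
move=> tB; rewrite [LHS]sqfrob_rows [sqfrob (Y - A *m X)]sqfrob_rows -big_split/=.
apply: eq_bigr => i _; rewrite !linearB/= !row_mul_band//.
by rewrite band_procrustes_solution -sqfrob_residual.
Qed.

Lemma procrustes_minimizer_solution : procrustes_minimizer X Y A.
Proof.
split=> // B tB; rewrite ler_frob (sqfrob_procrustes tB) lerDl.
by apply: sumr_ge0 => i _; apply: sqfrob_ge0.
Qed.

Lemma sqfrob_row_minimizer B i : procrustes_minimizer X Y B ->
  sqfrob (row i B) = sqfrob (row i A) + sqfrob (row i (B - A)).
Proof.
(* Comparing [B] with [A] makes the excess, a sum of squares, at most 0. Every term vanishes, so
   each band of [B] satisfies the hypothesis of [sqfrob_least_squares]. *)
case=> tB /(_ _ tA); rewrite ler_frob sqfrob_procrustes// gerDl => D0.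
have {}D0 : (band A i.+1 - band B i.+1) *m stencil X i.+1 = 0.
  apply: sqfrob_le0_eq0; apply: le_trans D0; rewrite (bigD1 i)//= lerDl.
  by apply: sumr_ge0 => j _; apply: sqfrob_ge0.
rewrite -!sqfrob_band//; last exact: tridiagonalB.
rewrite bandB band_procrustes_solution; apply: sqfrob_least_squares.
by apply/esym/eqP; rewrite -subr_eq0 -mulmxBl -band_procrustes_solution D0.
Qed.

Lemma min_row_norm_procrustes_solution : min_row_norm_solution X Y A.
Proof.
split=> [|B mB i]; first exact: procrustes_minimizer_solution.
by rewrite ler_frob (sqfrob_row_minimizer i mB) lerDl sqfrob_ge0.
Qed.

Lemma min_row_norm_frob_norm B :
  min_row_norm_solution X Y B -> min_frob_norm_solution X Y B.
Proof.
case=> mB rB; split=> // D /rB rBD; rewrite ler_frob !sqfrob_rows.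
by apply: ler_sum => i _; rewrite -ler_frob.
Qed.

(** Summing the row identities gives [sqfrob B = sqfrob A + sqfrob (B - A)], so minimality of [B]
    forces [B - A = 0]. *)
Lemma min_frob_norm_unique B : min_frob_norm_solution X Y B -> B = A.
Proof.
case=> mB /(_ _ procrustes_minimizer_solution).
rewrite ler_frob !(sqfrob_rows (_ : 'M_n)).
under eq_bigr => i _ do rewrite (sqfrob_row_minimizer i mB).
rewrite big_split/= gerDl -sqfrob_rows => /sqfrob_le0_eq0/eqP.
by rewrite subr_eq0 => /eqP.
Qed.

End TridiagonalProcrustes.

Theorem mainTheorem3 (R : realType) (n m : nat) (X Y : 'M[R[i]]_(n, m)) :
  exists A : 'M[R[i]]_n,
    [/\ tridiagonal A,
        forall i : nat, (1 <= i <= n)%N ->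
          band A i = row1b Y i *m mp_pinv (stencil X i),
        forall B : 'M[R[i]]_n, min_row_norm_solution X Y B <-> B = A
      & forall B : 'M[R[i]]_n, min_frob_norm_solution X Y B <-> B = A].
Proof.
exists (procrustes_solution X Y); split.
- exact: tridiagonal_procrustes_solution.
- case=> // k /= k_lt_n; rewrite -[k]/(nat_of_ord (Ordinal k_lt_n)).
  by rewrite band_procrustes_solution row1bS.
(* Rowwise minimality implies Frobenius minimality, so it inherits uniqueness. *)
- move=> B; split=> [/min_row_norm_frob_norm/min_frob_norm_unique//|->].
  exact: min_row_norm_procrustes_solution.
- move=> B; split=> [/min_frob_norm_unique//|->].
  exact/min_row_norm_frob_norm/min_row_norm_procrustes_solution.
Qed.
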